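(* If $n>5$ is of the form $n=2^m+1$ for some natural number $m$, then $\mathbf{L}_{n+1}$ and $\mathbf{L}^*_{n+1}$ are not term-equivalent.
   Context: For $n\ge 1$ let $L_{n+1}=\{0,1/n,2/n,\ldots,(n-1)/n,1\}$. The $(n+1)$-element MV-chain is $\mathbf{L}_{n+1}=(L_{n+1},\Rightarrow,\neg,0,1)$ with $x\Rightarrow y=\min\{1,1-x+y\}$ and $\neg x=1-x$. The algebra $\mathbf{L}^*_{n+1}=(L_{n+1},\vee,*,\neg,0,1)$ has the same universe and the operations $x\vee y=\max\{x,y\}$, $*x=\max\{0,2x-1\}$, $\neg x=1-x$, and the constants $0,1$. Two algebras on the same universe are term-equivalent if every basic operation of each is a term operation of the other. *)

(* Defs.v *)
From mathcomp Require Import all_boot all_order all_algebra.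
From mathcomp Require Import zify.
Set Implicit Arguments.
Unset Strict Implicit.
Unset Printing Implicit Defensive.
Import Order.TTheory GRing.Theory Num.Theory.
Local Open Scope ring_scope.

Record signature := Signature { op : Type; arity : op -> nat }.

Inductive term (S : signature) (k : nat) : Type :=
| Var of 'I_k
| App (f : op S) of ('I_(arity f) -> term S k).
Arguments Var {S k}.
Arguments App {S k}.

(* The universe is a parameter of the type, so that two algebras with
   different signatures can have literally the same universe. *)
Record algebra (A : Type) := Algebra {
  sig_of : signature;
  interp : forall f : op sig_of, ('I_(arity f) -> A) -> A }.
Arguments interp {A}.

Fixpoint eval (A : Type) (M : algebra A) (k : nat) (v : 'I_k -> A)
    (t : term (sig_of M) k) {struct t} : A :=
  match t with
  | Var i => v i
  | App f ts => interp M f (fun i => eval v (ts i))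
  end.

Definition term_operation (A : Type) (M : algebra A) (k : nat)
    (g : ('I_k -> A) -> A) : Prop :=
  exists t : term (sig_of M) k, forall v : 'I_k -> A, eval v t = g v.

Definition term_equivalent (A : Type) (M N : algebra A) : Prop :=
  (forall f : op (sig_of M), term_operation N (interp M f)) /\
  (forall f : op (sig_of N), term_operation M (interp N f)).

(* [L n] is the set L_{n+1}: it has n+1 elements (for n > 0). *)
Definition in_L (n : nat) (x : rat) : bool :=
  [exists k : 'I_n.+1, x == k%:R / n%:R].

Definition L (n : nat) : Type := {x : rat | in_L n x}.

Lemma in_LP (n : nat) (x : rat) :
  reflect (exists2 k : nat, (k <= n)%N & x = k%:R / n%:R) (in_L n x).
Proof.
apply: (iffP existsP) => [[k /eqP ->]|[k lekn ->]].
  by exists k => //; rewrite -ltnS.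
by exists (Ordinal (lekn : (k < n.+1)%N)).
Qed.

Section Closure.
Variables (n : nat) (n_gt0 : (0 < n)%N).

Let nz : n%:R != 0 :> rat.
Proof. by rewrite pnatr_eq0 -lt0n. Qed.

Lemma in_L0 : in_L n 0.
Proof. by apply/in_LP; exists 0%N => //; rewrite mul0r. Qed.

Lemma in_L1 : in_L n 1.
Proof. by apply/in_LP; exists n => //; rewrite divff. Qed.

Lemma in_L_neg (x : rat) : in_L n x -> in_L n (1 - x).
Proof.
move=> /in_LP[k lekn ->]; apply/in_LP; exists (n - k)%N; first exact: leq_subr.
by rewrite natrB // mulrBl divff.
Qed.

Lemma in_L_max (x y : rat) : in_L n x -> in_L n y -> in_L n (Num.max x y).
Proof. by move=> Lx Ly; rewrite maxEle; case: ifP. Qed.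

Lemma in_L_imp (x y : rat) :
  in_L n x -> in_L n y -> in_L n (Num.min 1 (1 - x + y)).
Proof.
move=> /in_LP[k lekn ->] /in_LP[l leln ->].
have -> : 1 - k%:R / n%:R + l%:R / n%:R = (n - k + l)%:R / n%:R :> rat.
  by rewrite natrD natrB // mulrDl mulrBl divff.
rewrite minEle; case: ifP => [_|/negbT]; first exact: in_L1.
rewrite -ltNge ltr_pdivrMr ?ltr0n // mul1r ltr_nat => /ltnW le.
by apply/in_LP; exists (n - k + l)%N.
Qed.

Lemma in_L_star (x : rat) : in_L n x -> in_L n (Num.max 0 (2 * x - 1)).
Proof.
move=> /in_LP[k lekn ->]; rewrite maxEle.
have -> : 2 * (k%:R / n%:R) - 1 = ((2 * k)%:R - n%:R) / n%:R :> rat.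
  by rewrite natrM mulrBl divff // mulrA.
case: ifP => [|_]; last exact: in_L0.
rewrite ler_pdivlMr ?ltr0n // mul0r subr_ge0 ler_nat => le.
apply/in_LP; exists (2 * k - n)%N; last by rewrite natrB.
by lia.
Qed.

End Closure.

Section Operations.
Variables (n : nat) (n_gt0 : (0 < n)%N).

Definition L_zero : L n := exist _ 0 (in_L0 n).
Definition L_one : L n := exist _ 1 (in_L1 n_gt0).
Definition L_neg (x : L n) : L n :=
  exist _ (1 - val x) (in_L_neg n_gt0 (valP x)).
Definition L_imp (x y : L n) : L n :=
  exist _ (Num.min 1 (1 - val x + val y)) (in_L_imp n_gt0 (valP x) (valP y)).
Definition L_join (x y : L n) : L n :=
  exist _ (Num.max (val x) (val y)) (in_L_max (valP x) (valP y)).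
Definition L_star (x : L n) : L n :=
  exist _ (Num.max 0 (2 * val x - 1)) (in_L_star n_gt0 (valP x)).

End Operations.

Inductive mv_op := MVimp | MVneg | MVzero | MVone.

Definition mv_signature : signature :=
  Signature (fun f => match f with
    | MVimp => 2 | MVneg => 1 | MVzero => 0 | MVone => 0 end%N).

Definition mv_chain (n : nat) (n_gt0 : (0 < n)%N) : algebra (L n) :=
  @Algebra (L n) mv_signature
    (fun f => match f return ('I_(@arity mv_signature f) -> L n) -> L n with
     | MVimp => fun v => L_imp n_gt0 (v ord0) (v ord_max)
     | MVneg => fun v => L_neg n_gt0 (v ord0)
     | MVzero => fun _ => L_zero n
     | MVone => fun _ => L_one n_gt0
     end).

Inductive star_op := Sjoin | Sstar | Sneg | Szero | Sone.

Definition star_signature : signature :=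
  Signature (fun f => match f with
    | Sjoin => 2 | Sstar => 1 | Sneg => 1 | Szero => 0 | Sone => 0 end%N).

Definition star_chain (n : nat) (n_gt0 : (0 < n)%N) : algebra (L n) :=
  @Algebra (L n) star_signature
    (fun f => match f return ('I_(@arity star_signature f) -> L n) -> L n with
     | Sjoin => fun v => L_join (v ord0) (v ord_max)
     | Sstar => fun v => L_star n_gt0 (v ord0)
     | Sneg => fun v => L_neg n_gt0 (v ord0)
     | Szero => fun _ => L_zero n
     | Sone => fun _ => L_one n_gt0
     end).

(* Main.v *)
Require Import Defs.
From mathcomp Require Import all_boot all_order all_algebra.
From mathcomp Require Import zify lra.
Import Order.TTheory GRing.Theory Num.Theory.

(** Term operations preserve every subuniverse, so it is enough to find a
    subuniverse of the star chain that is not closed under implication.  Take the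
    one generated by [1/n].  When [n = 2^m + 1], doubling [1/n] runs through
    [2/n, 4/n, ...] and reaches [2^m/n = 1 - 1/n], the negation of the
    starting point; hence [0], [1], the fractions [2^i/n] with [i <= m] and
    their negations already form a subuniverse ([star_chain_pow2_closed]).
    Implication and negation give truncated addition, so closure under
    implication would put [1/n + 2/n = 3/n] in this set.  But neither [3] nor
    [n - 3 = 2^m - 2] is a power of [2] as soon as [m >= 3]
    ([pow2_frac_not3]). *)

Definition subuniverse (A : Type) (M : algebra A) (P : A -> Prop) : Prop :=
  forall (f : op (sig_of M)) (v : 'I_(arity f) -> A),
    (forall i, P (v i)) -> P (interp M f v).

Lemma term_operation_preserves (A : Type) (M : algebra A) (P : A -> Prop)
    (k : nat) (g : ('I_k -> A) -> A) (v : 'I_k -> A) :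
  subuniverse A M P -> term_operation M g -> (forall i, P (v i)) -> P (g v).
Proof.
move=> closedP [t <-] Pv.
by elim: t => [i|f ts IH] /=; [apply: Pv | apply: closedP].
Qed.

(** Refutes term-equivalence: it suffices to exhibit a set closed under the
    operations of [N] but not under those of [M]. *)
Lemma term_equivalent_subuniverse (A : Type) (M N : algebra A) (P : A -> Prop) :
  term_equivalent M N -> subuniverse A N P -> subuniverse A M P.
Proof.
by move=> [MN _] closedP f v; apply: term_operation_preserves closedP (MN f).
Qed.

Section PowersOfTwo.
Local Open Scope ring_scope.

Variables n m : nat.

(** The fourth alternative is phrased through [1 - x] so that the set is visibly
    symmetric under negation. *)
Definition pow2_frac (x : rat) : Prop :=
  [\/ x = 0, x = 1,
      exists2 i : nat, (i <= m)%N & x = (2 ^ i)%:R / n%:R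
    | exists2 i : nat, (i <= m)%N & 1 - x = (2 ^ i)%:R / n%:R].

Lemma pow2_frac_neg (x : rat) : pow2_frac x -> pow2_frac (1 - x).
Proof.
case=> [->|->|[i im ->]|[i im e]].
- by rewrite subr0; apply: Or42.
- by rewrite subrr; apply: Or41.
- by apply: Or44; exists i; rewrite // subKr.
- by apply: Or43; exists i.
Qed.

Lemma pow2_frac_max (x y : rat) :
  pow2_frac x -> pow2_frac y -> pow2_frac (Num.max x y).
Proof. by move=> Px Py; rewrite maxEle; case: ifP. Qed.

Hypothesis n_form : n = (2 ^ m + 1)%N.

Let n_pos : (0 : rat) < n%:R.
Proof. by rewrite ltr0n n_form addn1. Qed.

Let pow2_over_n : (2 ^ m)%:R / n%:R = 1 - 1 / n%:R :> rat.
Proof.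
apply: (canRL (addrK _)).
by rewrite -mulrDl -(natrD _ _ 1) -n_form divff // lt0r_neq0.
Qed.

Lemma pow2_succ_le1 (i : nat) : (i < m)%N -> (2 ^ i.+1)%:R / n%:R <= 1 :> rat.
Proof.
move=> im; rewrite ler_pdivrMr // mul1r ler_nat n_form.
by rewrite (leq_trans (leq_pexp2l _ im)) // leq_addr.
Qed.

(** The doubling chain closes up at [i = m], where [2^m/n] and [1/n] are
    negations of each other: [2^m/n] is sent to [1 - 2/n], and [1/n] to [0].
    For [i < m], [2^i/n] lies below one half and is sent to [0], whereas
    [1 - 2^i/n] is sent to [1 - 2^(i+1)/n]. *)
Lemma pow2_frac_star (x : rat) :
  (0 < m)%N -> pow2_frac x -> pow2_frac (Num.max 0 (2 * x - 1)).
Proof.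
move=> m_gt0; have pow0 : pow2_frac 0 by apply: Or41.
have two_over_n_le1 : 2 / n%:R <= 1 :> rat by apply: (pow2_succ_le1 0).
have dbl i : (2 ^ i.+1)%:R / n%:R = 2 * ((2 ^ i)%:R / n%:R) :> rat.
  by rewrite expnS natrM mulrA.
case=> [->|->|[i]|[i]].
- by rewrite mulr0 sub0r max_l // lerN10.
- by rewrite mulr1 addrK max_r //; apply: Or42.
- rewrite leq_eqVlt => /predU1P[->|im] ->.
    rewrite pow2_over_n max_r; last by lra.
    by apply: Or44; exists 1%N => //; rewrite expn1; lra.
  by rewrite max_l //; have := pow2_succ_le1 i im; rewrite dbl; lra.
- rewrite leq_eqVlt => /predU1P[->|im] e.
    by rewrite max_l //; move: e; rewrite pow2_over_n; lra.
  have := pow2_succ_le1 i im; rewrite dbl => le1.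
  by rewrite max_r; [apply: Or44; exists i.+1 => //; rewrite dbl; lra | lra].
Qed.

(** Powers of two above [2] are multiples of [4].  This rules out [2^i = 3], and
    in [2^m = 2^i + 2] it forces [i = 1], that is [2^m = 4], although [8] divides
    [2^m]. *)
Lemma pow2_frac_not3 : (2 < m)%N -> ~ pow2_frac (3 / n%:R).
Proof.
move=> m_gt2; have n0 := lt0r_neq0 n_pos.
have m8 : (2 ^ m = 8 * 2 ^ (m - 3))%N by rewrite -(expnD 2 3) subnKC.
have m_pos : (0 < 2 ^ (m - 3))%N by rewrite expn_gt0.
have cancel a b : a%:R / n%:R = b%:R / n%:R :> rat -> a = b.
  by move/(mulIf (invr_neq0 n0))/eqP; rewrite eqr_nat => /eqP.
have pow2_cases i : [\/ 2 ^ i = 1, 2 ^ i = 2 | exists j, 2 ^ i = 4 * j]%N.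
  case: i => [|[|i]]; [exact: Or31 | exact: Or32 | apply: Or33].
  by exists (2 ^ i)%N; rewrite -(expnD 2 2).
case=> [e|e|[i _ /cancel e]|[i _ e]].
- by move: (@cancel 3 0); rewrite e mul0r => /(_ erefl).
- by have := @cancel 3 n; rewrite divff // => /(_ e); lia.
- by case: (pow2_cases i) => [||[j]]; lia.
- have /cancel : (3 + 2 ^ i)%:R / n%:R = n%:R / n%:R :> rat.
    by rewrite natrD mulrDl -e divff //; lra.
  by case: (pow2_cases i) => [||[j]]; lia.
Qed.

Lemma star_chain_pow2_closed (n_gt0 : (0 < n)%N) : (0 < m)%N ->
  subuniverse (L n) (star_chain n_gt0) (fun x => pow2_frac (val x)).
Proof.
move=> m_gt0 [] v Pv /=.
- by apply: pow2_frac_max; apply: Pv.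
- exact: (pow2_frac_star _ m_gt0 (Pv ord0)).
- exact: (pow2_frac_neg _ (Pv ord0)).
- exact: Or41.
- exact: Or42.
Qed.

(** Implication from [1 - 1/n] to [2/n] is the sum of [1/n] and [2/n]. *)
Lemma mv_chain_pow2_not_closed (n_gt0 : (0 < n)%N) : (2 < m)%N ->
  ~ subuniverse (L n) (mv_chain n_gt0) (fun x => pow2_frac (val x)).
Proof.
move=> m_gt2 closedP; apply: (pow2_frac_not3 m_gt2).
have n_ge3 : (3 <= n)%N.
  by rewrite n_form addn1 ltnS (leq_trans _ (leq_pexp2l _ m_gt2)).
have L1 : in_L n (1 / n%:R) by apply/in_LP; exists 1%N.
have L2 : in_L n (2 / n%:R) by apply/in_LP; exists 2%N; rewrite // ltnW.
pose x : L n := L_neg n_gt0 (exist _ (1 / n%:R) L1).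
pose y : L n := exist _ (2 / n%:R) L2.
have Px : pow2_frac (val x) by apply: pow2_frac_neg; apply: Or43; exists 0%N.
have Py : pow2_frac (val y).
  by apply: Or43; exists 1%N; rewrite // ltnW // ltnW.
have := closedP MVimp (fun i => if i == ord0 then x else y).
rewrite /= => /(_ (fun i => _)) P.
suff -> : 3 / n%:R = Num.min 1 (1 - (1 - 1 / n%:R) + 2 / n%:R) :> rat.
  by apply: P => i; case: ifP.
have le1 : 3 / n%:R <= 1 :> rat by rewrite ler_pdivrMr // mul1r ler_nat.
by rewrite min_r; lra.
Qed.

End PowersOfTwo.

Theorem lemma3p16 (n m : nat) (n_gt0 : 0 < n) (n_gt5 : 5 < n)
    (n_form : n = 2 ^ m + 1) :
  ~ term_equivalent (mv_chain n_gt0) (star_chain n_gt0).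
Proof.
have m_gt2 : 2 < m by case: m n_form => [|[|[|]]] //; lia.
move=> equiv; apply: (mv_chain_pow2_not_closed n m n_form n_gt0 m_gt2).
apply: term_equivalent_subuniverse equiv _.
by apply: star_chain_pow2_closed n_form n_gt0 _; apply: ltnW (ltnW m_gt2).
Qed.
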